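(* Let $K$ be a compact Hausdorff space, let $X$ be a Banach space and let $u\colon C(K)\to B(X)$ be a bounded homomorphism. Let $E_u=\{b\in B(X)\,:\, b\,u(f)=u(f)\,b \text{ for all } f\in C(K)\}$. (1) For any finite families $(f_k)_k$ in $C(K)$ and $(b_k)_k$ in $E_u$, we have $$\Bigl\Vert \sum_k u(f_k)b_k\Bigr\Vert \,\leq\, \Vert u\Vert^2\, \Bigl\Vert \sum_k f_k\otimes b_k\Bigr\Vert_R ,\qquad\text{where } \Bigl\Vert \sum_k f_k\otimes b_k\Bigr\Vert_R = R\Bigl(\Bigl\{\sum_k f_k(t)b_k \,:\, t\in K\Bigr\}\Bigr).$$ (2) There is a (necessarily unique) bounded linear map $$\widehat{u}\colon C(K)\mathop{\otimes}\limits^R E_u\longrightarrow B(X)$$ such that $\widehat{u}(f\otimes b)=u(f)b$ for any $f\in C(K)$ and any $b\in E_u$. Moreover $\Vert \widehat{u}\Vert\leq \Vert u\Vert^2$.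
   Context: $C(K)$ is the algebra of continuous functions $f\colon K\to\mathbb{C}$ with the supremum norm; $B(X)$ is the algebra of bounded linear operators on the complex Banach space $X$. A bounded homomorphism is a bounded linear multiplicative map (not assumed unital). $R$-boundedness: let $(\epsilon_k)_{k\geq 1}$ be independent Rademacher variables on a probability space $\Omega_0$ (values in $\{-1,1\}$, each with probability $\frac12$). For $x_1,\dots,x_n\in X$ put $\Vert\sum_k\epsilon_k\otimes x_k\Vert_{\mathrm{Rad}(X)}=\bigl(\int_{\Omega_0}\Vert\sum_k\epsilon_k(\lambda)x_k\Vert_X^2\,d\lambda\bigr)^{1/2}$. A set $\tau\subset B(X)$ is $R$-bounded if there is $C\geq0$ such that $\Vert\sum_k\epsilon_k\otimes T_kx_k\Vert_{\mathrm{Rad}(X)}\leq C\Vert\sum_k\epsilon_k\otimes x_k\Vert_{\mathrm{Rad}(X)}$ for all finite families $T_1,\dots,T_n\in\tau$, $x_1,\dots,x_n\in X$. The smallest such $C$ is denoted $R(\tau)$; $R(\tau)=\infty$ if $\tau$ is not $R$-bounded. An element $\sum_k f_k\otimes b_k$ of the algebraic tensor product $C(K)\otimes B(X)$ is identified with the function $t\mapsto\sum_k f_k(t)b_k$. The quantity $\Vert\cdot\Vert_R$ is finite and is a norm on $C(K)\otimes B(X)$. For a closed subspace $E\subset B(X)$, $C(K)\mathop{\otimes}\limits^R E$ denotes the completion of $C(K)\otimes E$ for the norm $\Vert\cdot\Vert_R$. *)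

(* Defs.v *)
From HB Require Import structures.
From mathcomp Require Import all_boot all_order all_algebra.
From mathcomp Require Import complex.
From mathcomp Require Import all_classical all_reals all_analysis.
Import Order.TTheory GRing.Theory Num.Theory.
Import numFieldNormedType.Exports.

Set Implicit Arguments.
Unset Strict Implicit.
Unset Printing Implicit Defensive.

Local Open Scope classical_set_scope.
Local Open Scope complex_scope.
Local Open Scope ring_scope.

(* In a normed module over R[i] the library norm `|x| is an element of R[i];
   rnorm x is the same number seen in R. *)
Section RealNorm.
Context {R : realType} {V : normedModType R[i]}.
Implicit Types x y : V.

Definition rnorm x : R := complex.Re `|x|.

Lemma rnormE x : `|x| = (rnorm x)%:C.
Proof. by rewrite /rnorm RRe_real // ger0_real. Qed.

Lemma rnorm_ge0 x : 0 <= rnorm x.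
Proof. by rewrite -lecR -rnormE; exact: normr_ge0. Qed.

Lemma rnorm0 : rnorm (0 : V) = 0.
Proof. by rewrite /rnorm normr0. Qed.

Lemma rnorm_eq0 x : rnorm x = 0 -> x = 0.
Proof. by move=> x0; apply/normr0_eq0; rewrite rnormE x0. Qed.

Lemma ler_rnormD x y : rnorm (x + y) <= rnorm x + rnorm y.
Proof. by rewrite -lecR rmorphD /= -!rnormE ler_normD. Qed.

Lemma rnormN x : rnorm (- x) = rnorm x.
Proof. by rewrite /rnorm normrN. Qed.

End RealNorm.

Lemma rnormZ {R : realType} {V : normedModType R[i]} (a : R[i]^o) (x : V) :
  rnorm (a *: x) = rnorm a * rnorm x.
Proof. by apply: complexI; rewrite rmorphM /= -!rnormE normrZ. Qed.

Lemma rnorm_real {R : realType} (r : R) : 0 <= r ->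
  rnorm (r%:C : R[i]^o) = r.
Proof.
by move=> r0; apply: complexI; rewrite -rnormE ger0_norm // lecR.
Qed.

Lemma rnormV {R : realType} (a : R[i]) :
  rnorm (a^-1 : R[i]^o) = (rnorm (a : R[i]^o))^-1.
Proof.
apply: complexI; rewrite fmorphV /= -!rnormE.
exact: (normfV (a : R[i])).
Qed.

Section BoundedMaps.
Context {R : realType} {V W : normedModType R[i]}.

Definition bounded_map (f : V -> W) : Prop :=
  exists M : R, forall x, rnorm (f x) <= M * rnorm x.

Definition opnorm (f : V -> W) : R :=
  sup [set rnorm (f x) | x in [set x | rnorm x <= 1]].

Lemma opnorm_ub (f : V -> W) : bounded_map f ->
  has_ubound [set rnorm (f x) | x in [set x | rnorm x <= 1]].
Proof.
case=> M fM; exists (Num.max M 0) => _ [x /= x1 <-].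
apply: (le_trans (fM x)); apply: (@le_trans _ _ (Num.max M 0 * rnorm x)).
  by apply: ler_wpM2r; [exact: rnorm_ge0 | rewrite le_max lexx].
by apply: ler_piMr => //; rewrite le_max lexx orbT.
Qed.

Lemma opnorm_ge0 (f : V -> W) : bounded_map f -> 0 <= opnorm f.
Proof.
move=> fb; apply: (le_trans (rnorm_ge0 (f 0))).
by apply: ub_le_sup; [exact: opnorm_ub | exists 0 => //=; rewrite rnorm0].
Qed.

Lemma opnorm_le (f : V -> W) (c : R) :
  (forall x, rnorm x <= 1 -> rnorm (f x) <= c) -> opnorm f <= c.
Proof.
move=> fc; apply: ge_sup => [|_ [x /= x1 <-]]; last exact: fc.
by exists (rnorm (f 0)), 0 => //=; rewrite rnorm0.
Qed.

Lemma rnorm_opnorm (f : V -> W) x : linear f -> bounded_map f ->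
  rnorm (f x) <= opnorm f * rnorm x.
Proof.
move=> fl fb.
have fZ a y : f (a *: y) = a *: f y.
  have f0 : f 0 = 0.
    by have := fl (-1) 0 0; rewrite scaleN1r addNr scaleN1r addNr.
  by have := fl a y 0; rewrite !addr0 f0 addr0.
have [x0|x0] := eqVneq (rnorm x) 0.
  rewrite (rnorm_eq0 x0) rnorm0 mulr0.
  by have := fZ 0 0; rewrite !scale0r => ->; rewrite rnorm0.
have xgt0 : 0 < rnorm x by rewrite lt_neqAle eq_sym x0 rnorm_ge0.
rewrite -ler_pdivrMr //; apply: ub_le_sup; first exact: opnorm_ub.
have nxV : rnorm (((rnorm x)^-1)%:C : R[i]^o) = (rnorm x)^-1.
  by rewrite rnorm_real // invr_ge0 rnorm_ge0.
exists (((rnorm x)^-1)%:C *: x) => /=.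
  by rewrite rnormZ nxV mulVf.
by rewrite fZ rnormZ nxV mulrC.
Qed.

End BoundedMaps.

Section ContinuousFunctions.
Context {R : realType} {K : topologicalType}.

Definition continuous_pred : {pred K -> R[i]^o} :=
  fun f => `[< continuous f >].

Lemma continuous_pred_subring : subring_closed continuous_pred.
Proof.
split=> [|f g|f g].
- by apply/asboolP => x; exact: cvg_cst.
- move=> /asboolP fc /asboolP gc; apply/asboolP => x.
  by apply: cvgB; [exact: fc | exact: gc].
- move=> /asboolP fc /asboolP gc; apply/asboolP => x.
  by apply: (@cvgZ _ R[i]^o); [exact: fc | exact: gc].
Qed.

Lemma continuous_pred_submod : subsemimod_closed continuous_pred.
Proof.
split; first split=> [|f g].
- by apply/asboolP => x; exact: cvg_cst.
- move=> /asboolP fc /asboolP gc; apply/asboolP => x.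
  by apply: cvgD; [exact: fc | exact: gc].
- move=> a f /asboolP fc; apply/asboolP => x.
  by apply: cvgZr; exact: fc.
Qed.

End ContinuousFunctions.

(* C(K); the compactness of K is an index of the type because the supremum
   norm is a norm only under that hypothesis. *)
Section CK.
Context (R : realType) {K : topologicalType}.

Record CK (cK : compact [set: K]) : Type := MkCK {
  CK_fun :> K -> R[i]^o;
  CK_funP : CK_fun \in continuous_pred
}.

Variable cK : compact [set: K].

HB.instance Definition _ := [isSub of CK cK for @CK_fun cK].
HB.instance Definition _ := [Choice of CK cK by <:].
HB.instance Definition _ := GRing.SubChoice_isSubComPzRing.Build
  (K -> R[i]^o) _ (CK cK) continuous_pred_subring.
HB.instance Definition _ := GRing.SubZmodule_isSubLmodule.Build
  R[i] (K -> R[i]^o) _ (CK cK) continuous_pred_submod.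

Implicit Types f g : CK cK.

Definition sup_norm f : R := sup [set rnorm (f t) | t in [set: K]].

Lemma CK_continuous f : continuous f.
Proof. exact/asboolP/(valP f). Qed.

Lemma CK_has_ubound f : has_ubound [set rnorm (f t) | t in [set: K]].
Proof.
have rc : continuous (fun t => rnorm (f t) : R).
  move=> t; apply/cvgrPdist_lt => e e0.
  have e0' : 0 < e%:C :> R[i] by rewrite ltcR.
  have /cvgrPdist_lt/(_ _ e0') := @CK_continuous f t.
  apply: filterS => s fts.
  have h : rnorm (f t - f s) < e by rewrite -ltcR -rnormE.
  apply: le_lt_trans h; rewrite ler_norml; apply/andP; split.
    rewrite lerNl opprB lerBlDr -[X in _ <= X + _]rnormN opprB.
    by apply: le_trans (ler_rnormD _ _); rewrite subrK.
  by rewrite lerBlDr; apply: le_trans (ler_rnormD _ _); rewrite subrK.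
have /compact_bounded[M [Mreal HM]] :
    compact ((fun t => rnorm (f t) : R) @` [set: K]).
  apply: continuous_compact => //.
  exact: continuous_subspaceT.
exists (M + 1) => _ [t _ <-].
have := HM (M + 1); rewrite ltrDl ltr01 => /(_ isT (rnorm (f t))).
rewrite /= ger0_norm ?rnorm_ge0 //; apply.
by exists t.
Qed.

Lemma le_sup_norm f t : rnorm (f t) <= sup_norm f.
Proof. by apply: ub_le_sup; [exact: CK_has_ubound | exists t]. Qed.

Lemma sup_norm_ge0 f : 0 <= sup_norm f.
Proof.
have [[t _]|K0] := pselect (exists t : K, True).
  exact: le_trans (rnorm_ge0 _) (le_sup_norm f t).
rewrite /sup_norm (_ : [set _ | _ in _] = set0) ?sup0 //.
by rewrite -subset0 => r [t _ _]; apply: K0; exists t.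
Qed.

Lemma sup_norm_le f c : 0 <= c -> (forall t, rnorm (f t) <= c) ->
  sup_norm f <= c.
Proof.
move=> c0 fc; have [[t _]|K0] := pselect (exists t : K, True).
  by apply: ge_sup => [|_ [s _ <-]//]; exists (rnorm (f t)), t.
rewrite /sup_norm (_ : [set _ | _ in _] = set0) ?sup0 //.
by rewrite -subset0 => r [t _ _]; apply: K0; exists t.
Qed.

Let CK_norm f : R[i] := (sup_norm f)%:C.

Let CK_normD f g : CK_norm (f + g) <= CK_norm f + CK_norm g.
Proof.
rewrite /CK_norm -rmorphD /= lecR; apply: sup_norm_le => [|t].
  by rewrite addr_ge0 ?sup_norm_ge0.
rewrite -[(f + g) t]/(f t + g t); apply: le_trans (ler_rnormD _ _) _.
by rewrite lerD ?le_sup_norm.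
Qed.

Let sup_normZ_le (a : R[i]) f :
  sup_norm (a *: f) <= rnorm (a : R[i]^o) * sup_norm f.
Proof.
have a0 : 0 <= rnorm (a : R[i]^o) by exact: rnorm_ge0.
apply: sup_norm_le => [|t]; first by rewrite mulr_ge0 ?sup_norm_ge0.
by rewrite -[(a *: f) t]/(a *: f t) rnormZ ler_wpM2l ?le_sup_norm.
Qed.

Let CK_normZ (a : R[i]) f : CK_norm (a *: f) = `|a| * CK_norm f.
Proof.
have aE : `|a| = (rnorm (a : R[i]^o))%:C.
  by rewrite -[LHS]/(`|a : R[i]^o|) rnormE.
rewrite /CK_norm aE -rmorphM /=; congr (_%:C).
apply/eqP; rewrite eq_le sup_normZ_le /=.
have [->|a0] := eqVneq a 0.
  by rewrite rnorm0 mul0r sup_norm_ge0.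
have agt0 : 0 < rnorm (a : R[i]^o) by rewrite -ltcR -aE normr_gt0.
rewrite -ler_pdivlMl //; apply: le_trans (_ : sup_norm (a^-1 *: (a *: f)) <= _).
  by rewrite scalerA mulVf // scale1r.
by apply: le_trans (sup_normZ_le _ _) _; rewrite rnormV.
Qed.

Let CK_norm0_eq0 f : CK_norm f = 0 -> f = 0.
Proof.
move=> /complexI f0; apply/val_inj/funext => t.
by apply/rnorm_eq0/le_anti; rewrite rnorm_ge0 -f0 le_sup_norm.
Qed.

HB.instance Definition _ :=
  Lmodule_isNormed.Build R[i] (CK cK) CK_normD CK_normZ CK_norm0_eq0.

End CK.

Section BX.
Context {R : realType} {X : normedModType R[i]}.

Definition bounded_op_pred : {pred X -> X} :=
  fun f => `[< linear f /\ bounded_map f >].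

Lemma bounded_op_submod : subsemimod_closed bounded_op_pred.
Proof.
split; first split=> [|f g].
- apply/asboolP; split=> [a x y|].
    by rewrite -[LHS]/(0 : X) -[(_ y)]/(0 : X) addr0 scaler0.
  by exists 0 => x; rewrite mul0r rnorm0.
- move=> /asboolP[fl [M fM]] /asboolP[gl [N gN]]; apply/asboolP.
  split=> [a x y|]; first by rewrite !fctE fl gl scalerDr addrACA.
  exists (M + N) => x; rewrite !fctE mulrDl.
  by apply: le_trans (ler_rnormD _ _) _; rewrite lerD.
- move=> a f /asboolP[fl [M fM]]; apply/asboolP; split=> [b x y|].
    by rewrite !fctE fl scalerDr !scalerA mulrC.
  exists (rnorm (a : R[i]^o) * M) => x; rewrite !fctE rnormZ -mulrA ler_wpM2l //.
  exact: rnorm_ge0.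
Qed.

End BX.

Section BXType.
Context {R : realType} (X : normedModType R[i]).

Record BX : Type := MkBX {
  BX_fun :> X -> X;
  BX_funP : BX_fun \in bounded_op_pred
}.

HB.instance Definition _ := [isSub for BX_fun].
HB.instance Definition _ := [Choice of BX by <:].
HB.instance Definition _ := GRing.SubChoice_isSubLmodule.Build
  R[i] (X -> X) _ BX bounded_op_submod.

Implicit Types S T : BX.

Lemma BX_linear T : linear T.
Proof. by have /asboolP[] := valP T. Qed.

Lemma BX_bounded T : bounded_map T.
Proof. by have /asboolP[] := valP T. Qed.

Lemma BX_comp_subproof S T : S \o T \in bounded_op_pred.
Proof.
apply/asboolP; split=> [a x y|]; first by rewrite /= !BX_linear.
exists (opnorm S * opnorm T) => x /=; rewrite -mulrA.
apply: le_trans (rnorm_opnorm _ (BX_linear S) (BX_bounded S)) _.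
rewrite ler_wpM2l ?opnorm_ge0 //; first exact: BX_bounded.
exact: rnorm_opnorm (BX_linear T) (BX_bounded T).
Qed.

Lemma BX_id_subproof : @idfun X \in bounded_op_pred.
Proof. by apply/asboolP; split=> //; exists 1 => x; rewrite mul1r. Qed.

Definition BX_comp S T : BX := MkBX (BX_comp_subproof S T).
Definition BX_id : BX := MkBX BX_id_subproof.

Let BX_compA : associative BX_comp.
Proof. by move=> S T U; exact: val_inj. Qed.
Let BX_comp1l : left_id BX_id BX_comp.
Proof. by move=> S; exact: val_inj. Qed.
Let BX_comp1r : right_id BX_id BX_comp.
Proof. by move=> S; exact: val_inj. Qed.
Let BX_compDl : left_distributive BX_comp +%R.
Proof. by move=> S T U; exact: val_inj. Qed.
Let BX_compDr : right_distributive BX_comp +%R.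
Proof.
move=> S T U; apply/val_inj/funext => x /=.
by have := BX_linear S 1 (T x) (U x); rewrite !scale1r.
Qed.

HB.instance Definition _ := GRing.Zmodule_isPzRing.Build BX
  BX_compA BX_comp1l BX_comp1r BX_compDl BX_compDr.

Let BX_norm T : R[i] := (opnorm T)%:C.

Let BX_normD S T : BX_norm (S + T) <= BX_norm S + BX_norm T.
Proof.
rewrite /BX_norm -rmorphD /= lecR; apply: opnorm_le => x x1.
apply: le_trans (ler_rnormD _ _) _; apply: lerD; apply: ub_le_sup;
  by [exact/opnorm_ub/BX_bounded | exists x].
Qed.

Let opnormZ_le (a : R[i]) T :
  opnorm (a *: T) <= rnorm (a : R[i]^o) * opnorm T.
Proof.
apply: opnorm_le => x x1; rewrite rnormZ ler_wpM2l //.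
  exact: rnorm_ge0.
by apply: ub_le_sup; [exact/opnorm_ub/BX_bounded | exists x].
Qed.

Let BX_normZ (a : R[i]) T : BX_norm (a *: T) = `|a| * BX_norm T.
Proof.
have aE : `|a| = (rnorm (a : R[i]^o))%:C.
  by rewrite -[LHS]/(`|a : R[i]^o|) rnormE.
rewrite /BX_norm aE -rmorphM /=; congr (_%:C).
apply/eqP; rewrite eq_le opnormZ_le /=.
have [->|a0] := eqVneq a 0.
  by rewrite rnorm0 mul0r opnorm_ge0 //; exact: (BX_bounded (0 *: T)).
have agt0 : 0 < rnorm (a : R[i]^o) by rewrite -ltcR -aE normr_gt0.
rewrite -ler_pdivlMl //.
apply: le_trans (_ : opnorm (a^-1 *: (a *: T)) <= _).
  by rewrite scalerA mulVf // scale1r.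
by apply: le_trans (opnormZ_le _ _) _; rewrite rnormV.
Qed.

Let BX_norm0_eq0 T : BX_norm T = 0 -> T = 0.
Proof.
move=> /complexI T0; apply/val_inj/funext => x.
apply/rnorm_eq0/le_anti; rewrite rnorm_ge0 andbT.
by rewrite (le_trans (rnorm_opnorm x (BX_linear T) (BX_bounded T))) // T0 mul0r.
Qed.

HB.instance Definition _ :=
  Lmodule_isNormed.Build R[i] BX BX_normD BX_normZ BX_norm0_eq0.

End BXType.

Section RademacherAndRBounds.
Context {R : realType} {d : measure_display} {Omega : measurableType d}.
Context (P : probability Omega R).

Definition independent_RVs (eps : nat -> {RV P >-> R}) : Prop :=
  forall (s : seq nat) (B : nat -> set R), uniq s ->
    (forall k, measurable (B k)) ->
    P (\bigcap_(k in [set` s]) (eps k @^-1` B k)) =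
    (\prod_(k <- s) P (eps k @^-1` B k))%E.

Definition rademacher_sequence (eps : nat -> {RV P >-> R}) : Prop :=
  [/\ independent_RVs eps,
      forall k w, eps k w = 1 \/ eps k w = -1,
      forall k, P (eps k @^-1` [set 1]) = (2^-1)%:E &
      forall k, P (eps k @^-1` [set -1]) = (2^-1)%:E].

Variable eps : nat -> {RV P >-> R}.

Definition rad_norm {X : normedModType R[i]} (n : nat) (x : 'I_n -> X) : R :=
  Num.sqrt
    (\int[P]_w (rnorm (\sum_(k < n) (eps k w)%:C *: x k) ^+ 2))%R.

Context {X : normedModType R[i]}.

Definition R_bounded_by (tau : set (BX X)) (c : R) : Prop :=
  0 <= c /\
  forall (n : nat) (T : 'I_n -> BX X) (x : 'I_n -> X),
    (forall k, tau (T k)) ->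
    rad_norm (fun k => T k (x k)) <= c * rad_norm x.

(* R(tau), equal to +oo when tau is not R-bounded. *)
Definition R_bound (tau : set (BX X)) : \bar R :=
  ereal_inf [set c%:E | c in R_bounded_by tau].

(* The norm ||.||_R of a tensor, seen as a function K -> B(X). *)
Definition norm_R {K : Type} (F : K -> BX X) : \bar R := R_bound (range F).

End RademacherAndRBounds.

(* The algebraic tensor product C(K) (x) E, identified with the space of the
   functions t |-> \sum_k f_k(t) b_k with f_k in C(K) and b_k in E. *)
Section AlgebraicTensor.
Context {R : realType} {K : topologicalType} (cK : compact [set: K]).
Context {X : normedModType R[i]}.

Definition tensor_fun (n : nat) (f : 'I_n -> CK R cK) (b : 'I_n -> BX X) :
    K -> BX X :=
  fun t => \sum_(k < n) (f k t : R[i]) *: b k.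

Definition tensor_pred (E : set (BX X)) : {pred K -> BX X} :=
  fun F => `[< exists (n : nat) (f : 'I_n -> CK R cK) (b : 'I_n -> BX X),
                 (forall k, E (b k)) /\ F = tensor_fun f b >].

Lemma tensor_submod E : subsemimod_closed (tensor_pred E).
Proof.
split; first split=> [|F G].
- apply/asboolP; exists 0%N, (fun=> 0), (fun=> 0); split=> [[]//|].
  by apply/funext => t; rewrite /tensor_fun big_ord0.
- move=> /asboolP[m [f [b [Eb ->]]]] /asboolP[n [g [c [Ec ->]]]].
  apply/asboolP; exists (m + n)%N,
    (fun k => match fintype.split k with inl i => f i | inr j => g j end),
    (fun k => match fintype.split k with inl i => b i | inr j => c j end).
  split=> [k|]; first by case: fintype.splitP.
  apply/funext => t; rewrite /tensor_fun big_split_ord /=.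
  congr (_ + _); apply: eq_bigr => i _.
    by rewrite -[lshift n i]/(unsplit (inl i)) unsplitK.
  by rewrite -[rshift m i]/(unsplit (inr i)) unsplitK.
- move=> a F /asboolP[n [f [b [Eb ->]]]]; apply/asboolP.
  exists n, (fun k => a *: f k), b; split=> //.
  apply/funext => t; rewrite /tensor_fun /GRing.scale /= scaler_sumr.
  by apply: eq_bigr => k _; rewrite scalerA.
Qed.

End AlgebraicTensor.

Section TensorType.
Context {R : realType} {K : topologicalType} (cK : compact [set: K]).
Context {X : normedModType R[i]} (E : set (BX X)).

Record tensor : Type := MkTensor {
  tensor_val :> K -> BX X;
  tensor_valP : tensor_val \in tensor_pred cK E
}.

HB.instance Definition _ := [isSub for tensor_val].
HB.instance Definition _ := [Choice of tensor by <:].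
HB.instance Definition _ := GRing.SubChoice_isSubLmodule.Build
  R[i] (K -> BX X) _ tensor (tensor_submod cK E).

Lemma pure_tensor_subproof (f : CK R cK) (b : BX X) : E b ->
  (fun t => (f t : R[i]) *: b) \in tensor_pred cK E.
Proof.
move=> Eb; apply/asboolP; exists 1%N, (fun=> f), (fun=> b); split=> //.
by apply/funext => t; rewrite /tensor_fun big_ord_recl big_ord0 addr0.
Qed.

Definition pure_tensor (f : CK R cK) (b : BX X) (Eb : E b) : tensor :=
  MkTensor (pure_tensor_subproof f Eb).

End TensorType.

(* The completion C(K) (x)^R E is determined up to isometric isomorphism: it is
   any Banach space Z with a linear map i from C(K) (x) E into Z that is
   isometric for ||.||_R and has dense range. *)
Definition is_R_completion {R : realType} {d : measure_display}
    {Omega : measurableType d} (P : probability Omega R)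
    (eps : nat -> {RV P >-> R})
    {K : topologicalType} (cK : compact [set: K]) {X : normedModType R[i]}
    (E : set (BX X)) (Z : completeNormedModType R[i])
    (i : {linear tensor cK E -> Z}) : Prop :=
  (forall F : tensor cK E, (rnorm (i F))%:E = norm_R eps F) /\
  dense (range i).

Definition commutant {R : realType} {K : topologicalType}
    {cK : compact [set: K]} {X : normedModType R[i]}
    (u : CK R cK -> BX X) : set (BX X) :=
  [set b | forall f : CK R cK, b * u f = u f * b].

(* Main.v *)
(** Fix a bound [c] for the family [F(t) = \sum_k f_k(t) b_k]. If the functions
    [psi_j] have disjoint supports and values in [0, 1], then for every choice of
    signs [e_j] the operator [\sum_j u(psi_j^2) F(t_j)] is the product of
    [u(\sum_j e_j psi_j)] and [\sum_j e_j F(t_j) u(psi_j)], whence its norm is at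
    most [|u|^2 c]. Disjoint systems cannot sum up to 1, and spectral projections
    (which would live in the bidual) are avoided by averaging: cutting the values
    of the [f_k] along [N] interlaced grids gives [N] disjoint systems of small
    oscillation such that the [N] remainders [1 - \sum_j psi_j^2] add up to a
    function bounded independently of [N]. The average over the [N] grids of the
    remainder terms is therefore [O(1/N)]. *)
Require Import Defs.
From HB Require Import structures.
From mathcomp Require Import all_boot all_order all_algebra.
From mathcomp Require Import complex.
From mathcomp Require Import all_classical all_reals all_analysis.
From mathcomp Require Import lra zify ring.
Import Order.TTheory GRing.Theory Num.Theory.
Import numFieldNormedType.Exports.

Local Open Scope classical_set_scope.
Local Open Scope complex_scope.
Local Open Scope ring_scope.

(** * Integrals and Rademacher norms *)

Section Integral.
Context {R : realType} {d : measure_display} {T : measurableType d}.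
Implicit Types mu : {measure set T -> \bar R}.

(* Monotone without measurability: the integral of a nonnegative function is
   a supremum over the simple functions below it. *)
Lemma ge0_le_integral_nomeas mu (f g : T -> \bar R) :
  (forall x, 0 <= f x)%E -> (forall x, f x <= g x)%E ->
  (\int[mu]_x f x <= \int[mu]_x g x)%E.
Proof.
move=> f0 fg; rewrite !ge0_integralTE//; last by move=> x; exact: le_trans (fg x).
apply: le_ereal_sup => _ [h /= hf <-]; exists h => //= x.
exact: le_trans (hf x) (fg x).
Qed.

(** Comparison with the constants [a] and [b], each of which integrates to itself against a
    probability. The upper bound makes the extended integral finite, so that passing to its real
    value loses nothing. *)
Lemma Rintegral_between (P : probability T R) (f : T -> R) {a b : R} :
  0 <= a -> (forall w, a <= f w <= b) -> a <= (\int[P]_w f w)%R <= b.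
Proof.
move=> a0 fab.
have fa w : a <= f w by case/andP: (fab w).
have fb w : f w <= b by case/andP: (fab w).
have f0 w : (0 <= (f w)%:E)%E by rewrite lee_fin (le_trans a0).
have intc c : (\int[P]_w (cst c%:E) w)%E = c%:E.
  by rewrite integral_cst// [X in (_ * X)%E](@probability_setT _ _ _ P) mule1.
have aI : (a%:E <= \int[P]_w (f w)%:E)%E.
  by rewrite -(intc a); apply: ge0_le_integral_nomeas => w; rewrite /= lee_fin.
have Ib : (\int[P]_w (f w)%:E <= b%:E)%E.
  by rewrite -(intc b); apply: ge0_le_integral_nomeas => w //; rewrite /= lee_fin.
have Ifin : (\int[P]_w (f w)%:E)%E \is a fin_num.
  by rewrite ge0_fin_numE ?integral_ge0// (le_lt_trans Ib)// ltry.
by rewrite /Rintegral -!lee_fin fineK// aI Ib.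
Qed.

End Integral.

Lemma rnorm_sum {R : realType} {V : normedModType R[i]} (I : Type) (r : seq I)
    (Q : pred I) (x : I -> V) :
  rnorm (\sum_(k <- r | Q k) x k) <= \sum_(k <- r | Q k) rnorm (x k).
Proof.
elim/big_ind2 : _ => [|x1 x2 y1 y2 h1 h2|//]; first by rewrite rnorm0.
exact: le_trans (ler_rnormD _ _) (lerD h1 h2).
Qed.

Section RadNorm.
Context {R : realType} {d : measure_display} {Omega : measurableType d}.
Context (P : probability Omega R) (eps : nat -> {RV P >-> R}).
Hypothesis heps : rademacher_sequence eps.
Context {X : normedModType R[i]}.

Lemma rnorm_rademacher k w : rnorm ((eps k w)%:C : R[i]^o) = 1.
Proof.
case: heps => _ /(_ k w) [] -> _ _; first by rewrite rnorm_real.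
by rewrite rmorphN /= rnormN rnorm_real.
Qed.

Lemma rademacherK k w : (eps k w)%:C * (eps k w)%:C = 1 :> R[i].
Proof.
case: heps => _ /(_ k w) [] -> _ _; first by rewrite mulr1.
by rewrite rmorphN /= mulrNN mulr1.
Qed.

Lemma rad_norm_le n (x : 'I_n -> X) (b : R) : 0 <= b ->
  (forall w, rnorm (\sum_(k < n) (eps k w)%:C *: x k) <= b) ->
  rad_norm eps x <= b.
Proof.
move=> b0 xb; rewrite /rad_norm -[leRHS]ger0_norm// -sqrtr_sqr; apply: ler_wsqrtr.
apply: (proj2 (andP (Rintegral_between P _ (a := 0) _ _))) => // w.
by rewrite exprn_ge0 ?rnorm_ge0//= lerXn2r// nnegrE rnorm_ge0.
Qed.

Lemma rad_norm_ge n (x : 'I_n -> X) (a : R) : 0 <= a ->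
  (forall w, a <= rnorm (\sum_(k < n) (eps k w)%:C *: x k)) ->
  a <= rad_norm eps x.
Proof.
move=> a0 ax; rewrite /rad_norm -[leLHS]ger0_norm// -sqrtr_sqr; apply: ler_wsqrtr.
(* The square of the sum of the norms serves as upper bound; its only task is to keep the integral
   finite. *)
apply: (proj1 (andP (Rintegral_between P _ (b := (\sum_(k < n) rnorm (x k)) ^+ 2) _ _))).
  exact: exprn_ge0.
move=> w.
have xb : rnorm (\sum_(k < n) (eps k w)%:C *: x k) <= \sum_(k < n) rnorm (x k).
  apply: le_trans (rnorm_sum _ _ _ _) _.
  by apply: ler_sum => k _; rewrite rnormZ rnorm_rademacher mul1r.
have b0 := le_trans (rnorm_ge0 _) xb.
by rewrite !lerXn2r ?nnegrE ?rnorm_ge0.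
Qed.

End RadNorm.

(** * Disjoint systems *)

Section OperatorAlgebra.
Context {R : realType} {X : normedModType R[i]}.
Implicit Types S T : BX X.

Lemma BX_scalerAl (a : R[i]) S T : (a *: S) * T = a *: (S * T).
Proof. exact: val_inj. Qed.

Lemma BX_linearZ T (a : R[i]) x : T (a *: x) = a *: T x.
Proof.
have T0 : T 0 = 0.
  by have := BX_linear T (-1) 0 0; rewrite scaleN1r addNr scaleN1r addNr.
by have := BX_linear T a x 0; rewrite !addr0 T0 addr0.
Qed.

Lemma BX_scalerAr (a : R[i]) S T : S * (a *: T) = a *: (S * T).
Proof. by apply/val_inj/funext => x; exact: BX_linearZ. Qed.

Lemma BX_sumE (I : Type) (r : seq I) (Q : pred I) (T : I -> BX X) x :
  (\sum_(k <- r | Q k) T k) x = \sum_(k <- r | Q k) T k x.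
Proof. by elim/big_rec2 : _ => // k y1 y2 _ <-. Qed.

Lemma BX_rnorm_le T x : rnorm (T x) <= rnorm T * rnorm x.
Proof. exact: rnorm_opnorm (BX_linear T) (BX_bounded T). Qed.

Lemma BX_rnormM S T : rnorm (S * T) <= rnorm S * rnorm T.
Proof.
apply: opnorm_le => x x1; apply: le_trans (BX_rnorm_le S (T x)) _.
rewrite ler_wpM2l ?rnorm_ge0//; apply: le_trans (BX_rnorm_le T x) _.
by rewrite ler_piMr ?rnorm_ge0.
Qed.

Lemma le_rnorm_BX T (c : R) : 0 <= c -> (forall x, rnorm (T x) <= c * rnorm x) ->
  rnorm T <= c.
Proof.
by move=> c0 Tc; apply: opnorm_le => x x1; apply: le_trans (Tc x) (ler_piMr _ _).
Qed.

End OperatorAlgebra.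

Lemma CK_sumE {R : realType} {K : topologicalType} {cK : compact [set: K]}
    (I : Type) (r : seq I) (Q : pred I) (f : I -> CK R cK) t :
  (\sum_(k <- r | Q k) f k) t = \sum_(k <- r | Q k) f k t.
Proof. by elim/big_rec2 : _ => // k y1 y2 _ <-. Qed.

Lemma CK_mulE {R : realType} {K : topologicalType} {cK : compact [set: K]}
    (f g : CK R cK) t : (f * g) t = (f t : R[i]) * g t.
Proof. by []. Qed.

Lemma CK_subE {R : realType} {K : topologicalType} {cK : compact [set: K]}
    (f g : CK R cK) t : (f - g) t = f t - g t.
Proof. by []. Qed.

Lemma CK_scaleE {R : realType} {K : topologicalType} {cK : compact [set: K]}
    (a : R[i]) (f : CK R cK) t : (a *: f) t = a * f t.
Proof. by []. Qed.

Lemma rnorm_CKZ {R : realType} {K : topologicalType} {cK : compact [set: K]}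
    (a : R[i]) (f : CK R cK) t :
  rnorm ((a *: f) t) = rnorm (a : R[i]^o) * rnorm (f t).
Proof. exact: rnormZ. Qed.

Section Homomorphism.
Context {R : realType} {d : measure_display} {Omega : measurableType d}.
Context {P : probability Omega R} {eps : nat -> {RV P >-> R}}.
Hypothesis heps : rademacher_sequence eps.
Context {K : topologicalType} {cK : compact [set: K]}.
Context {X : normedModType R[i]}.
Context {u : {linear CK R cK -> BX X}}.
Hypothesis ub : bounded_map u.
Hypothesis uM : forall f g : CK R cK, u (f * g) = u f * u g.

Lemma rnorm_u f : rnorm (u f) <= opnorm u * rnorm f.
Proof. by apply: rnorm_opnorm ub => a x y; exact: linearP. Qed.

Lemma rnorm_u_le (f : CK R cK) (c : R) : 0 <= c -> (forall t, rnorm (f t) <= c) ->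
  rnorm (u f) <= opnorm u * c.
Proof.
move=> c0 fc; apply: le_trans (rnorm_u f) _.
by rewrite ler_wpM2l ?opnorm_ge0//; exact: sup_norm_le.
Qed.

(* Since the [psi j] are disjoint, for every choice of signs the sum is the
   product of [\sum_j e_j u (psi j)] and [\sum_j e_j T j (u (psi j))]; both
   [\sum_j e_j psi j] have norm at most 1, so averaging the squares over the
   signs brings in the R-bound. *)
Lemma disjoint_sum_bound {tau : set (BX X)} {c : R} : R_bounded_by eps tau c ->
  forall m (psi : 'I_m -> CK R cK) (T : 'I_m -> BX X),
  (forall j t, rnorm (psi j t) <= 1) ->
  (forall i j, i != j -> psi i * psi j = 0) ->
  (forall j, tau (T j)) -> (forall j, commutant u (T j)) ->
  rnorm (\sum_(j < m) u (psi j * psi j) * T j) <= opnorm u ^+ 2 * c.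
Proof.
move=> [c0 tauc] m psi T psi1 psi_disj tauT uT.
have u0 : 0 <= opnorm u by exact: opnorm_ge0.
pose A w : CK R cK := \sum_(j < m) ((eps j w)%:C : R[i]) *: psi j.
pose Y w : BX X := \sum_(j < m) ((eps j w)%:C : R[i]) *: (T j * u (psi j)).
(* At each point at most one [psi j] is nonzero, and the signs have modulus 1. *)
have A1 w : sup_norm (A w) <= 1.
  apply: sup_norm_le => // t; rewrite CK_sumE.
  have [[j jt]|h] := pselect (exists j, psi j t != 0).
    rewrite (big_only1 j) // => [|i ij _].
      by rewrite rnorm_CKZ (rnorm_rademacher _ _ heps) mul1r.
    rewrite CK_scaleE; have := CK_mulE (psi i) (psi j) t.
    rewrite psi_disj// => /esym/eqP; rewrite mulf_eq0 (negbTE jt) orbF => /eqP->.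
    exact: mulr0.
  rewrite big1 ?rnorm0// => j _; rewrite CK_scaleE.
  have [jt|jt] := eqVneq (psi j t) 0; first by rewrite jt; exact: mulr0.
  by case: h; exists j.
have uA w : rnorm (u (A w)) <= opnorm u.
  by rewrite -[leRHS]mulr1; apply: le_trans (rnorm_u _) _; rewrite ler_wpM2l//; exact: A1.
(* Off-diagonal products vanish by disjointness; on the diagonal the sign occurs squared. The
   commutation of [T j] with [u] brings the two factors [u (psi j)] together. *)
have SE w : \sum_(j < m) u (psi j * psi j) * T j = u (A w) * Y w.
  rewrite linear_sum mulr_suml; apply: eq_bigr => i _.
  rewrite mulr_sumr (bigD1 i)//= big1 ?addr0 => [|j ji].
    rewrite linearZ BX_scalerAl BX_scalerAr scalerA (rademacherK _ _ heps) scale1r.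
    by rewrite uT mulrA -uM.
  rewrite linearZ BX_scalerAl BX_scalerAr uT mulrA -uM psi_disj 1?eq_sym//.
  by rewrite linear0 mul0r !scaler0.
apply: le_rnorm_BX => [|x]; first by rewrite mulr_ge0 ?exprn_ge0.
set S := \sum_(j < m) _ in SE *.
have YE w : Y w x = \sum_(j < m) ((eps j w)%:C : R[i]) *: T j (u (psi j) x).
  by rewrite BX_sumE.
have Sx w : rnorm (S x) <= opnorm u * rnorm (Y w x).
  rewrite (SE w); apply: le_trans (BX_rnorm_le (u (A w)) (Y w x)) _.
  by rewrite ler_wpM2r ?rnorm_ge0.
rewrite expr2 -!mulrA.
have [v0|v0] := eqVneq (opnorm u) 0.
  by have := Sx point; rewrite v0 !mul0r.
have vgt0 : 0 < opnorm u by rewrite lt_neqAle eq_sym v0.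
(* For every sample, the signed sum of the [T j (u (psi j) x)] is at least [rnorm (S x)] divided by
   [opnorm u], hence so is its Rademacher norm. R-boundedness then removes the [T j] and leaves
   [u (A w) x], of norm at most [opnorm u * rnorm x]. *)
rewrite -ler_pdivrMl//; apply: le_trans (_ : rad_norm eps (fun j => T j (u (psi j) x)) <= _).
  apply: (rad_norm_ge _ _ heps) => [|w]; first by rewrite mulr_ge0 ?invr_ge0 ?rnorm_ge0.
  by rewrite -YE ler_pdivrMl.
apply: le_trans (tauc _ _ _ tauT) _; rewrite mulrCA ler_wpM2l//.
apply: rad_norm_le => [|w]; first by rewrite mulr_ge0 ?rnorm_ge0.
rewrite (_ : \sum_(k < m) _ = u (A w) x).
  by apply: le_trans (BX_rnorm_le _ _) _; rewrite ler_wpM2r ?rnorm_ge0.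
by rewrite linear_sum BX_sumE; apply: eq_bigr => j _; rewrite linearZ.
Qed.

End Homomorphism.

(** * Interlaced grids *)

Section Trapezoid.
Context {R : realType}.
Implicit Types (N s l M : nat) (a y : R).

(** A bump supported in [a, a + N], with slopes 1 and -1 on the unit margins and value 1 on
    [a + 1, a + N - 1] when that interval is nonempty. *)
Definition trapezoid N a y : R :=
  Num.max 0 (Num.min 1 (Num.min (y - a) (a + N%:R - y))).

Lemma trapezoid_ge0 N a y : 0 <= trapezoid N a y.
Proof. by rewrite le_max lexx. Qed.

Lemma trapezoid_le1 N a y : trapezoid N a y <= 1.
Proof. by rewrite ge_max ler01 ge_min lexx. Qed.

Lemma trapezoid_neq0 N a y : trapezoid N a y != 0 -> a < y < a + N%:R.
Proof.
apply: contraNT => h; apply/eqP/max_idPl; rewrite !ge_min subr_le0 subr_le0.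
by move: h; rewrite negb_and -!leNgt => ->; rewrite orbT.
Qed.

Lemma trapezoid_eq1 N a y : a + 1 <= y -> y + 1 <= a + N%:R ->
  trapezoid N a y = 1.
Proof.
move=> ay yN; rewrite /trapezoid (min_idPl _) ?(max_idPr _)//.
by rewrite le_min; apply/andP; split; lra.
Qed.

(* For a fixed shift [s], the cells are the [N]-periodic translates of a
   trapezoid supported between two consecutive integers congruent to [s]. *)
Definition cell N s l y : R := trapezoid N (s%:R + N%:R * l%:R - N%:R) y.

Lemma cell_disjoint N s l l' y : l != l' -> cell N s l y * cell N s l' y = 0.
Proof.
wlog ll' : l l' / (l < l')%N.
  move=> W; rewrite neq_ltn => /orP[|] h; first by apply: W => //; rewrite ltn_eqF.
  by rewrite mulrC; apply: W => //; rewrite ltn_eqF.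
move=> _; apply/eqP; rewrite mulf_eq0 -[_ || _]negbK negb_or; apply/negP.
move=> /andP[/trapezoid_neq0/andP[_ h1] /trapezoid_neq0/andP[h2 _]].
have : N%:R * l.+1%:R <= N%:R * l'%:R :> R by rewrite -!natrM ler_nat leq_mul.
rewrite -natr1 mulrDr mulr1 => h3; lra.
Qed.

(** At most one term is nonzero, and its weight lies in [0, 1]. With [e] constantly 1 this bounds a
    sum of squares. *)
Lemma disjoint_weighted_le (I : finType) (g e : I -> R) (b : R) : 0 <= b ->
  (forall i, 0 <= g i <= 1) -> (forall i j, i != j -> g i * g j = 0) ->
  (forall i, g i != 0 -> e i <= b) -> \sum_i g i ^+ 2 * e i <= b.
Proof.
move=> b0 g01 gd eb; have [[i gi]|h] := pselect (exists i, g i != 0).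
  rewrite (big_only1 i)// => [|j ji _].
    have /andP[g0 g1] := g01 i.
    have := eb _ gi; have : 0 <= g i ^+ 2 <= 1 by rewrite exprn_ge0//= exprn_ile1.
    by nra.
  have /eqP := gd _ _ ji; rewrite mulf_eq0 (negbTE gi) orbF => /eqP->.
  by rewrite expr0n mul0r.
rewrite big1// => i _; have [->|gi] := eqVneq (g i) 0; first by rewrite expr0n mul0r.
by case: h; exists i.
Qed.

(** Each residual is at most 1, and it vanishes unless [y] is within distance 1 of a grid point. For
    [y] in [i, i + 1) this leaves only the shifts congruent to [i] or [i + 1] modulo [N], so the
    bound does not depend on [N]. *)
Lemma cell_residual N M y : (0 < N)%N -> 0 <= y <= M%:R ->
  \sum_(s < N) (1 - \sum_(l < M.+2) cell N s l y ^+ 2) <= 2.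
Proof.
move=> N0 /andP[y0 yM]; pose i := Num.truncn y.
have /andP[iy yi] : i%:R <= y < i.+1%:R by exact: truncn_itv.
have iM : (i <= M)%N by rewrite -(ler_nat R) (le_trans iy).
have ind1 (c : nat) : \sum_(s < N) ((s == c :> nat)%:R : R) <= 1.
  have [cN|cN] := ltnP c N.
    rewrite (big_only1 (Ordinal cN)) ?eqxx// => j; rewrite -val_eqE /= => /negbTE->//.
  rewrite big1// => s _; rewrite ltn_eqF//; exact: leq_trans (ltn_ord s) cN.
apply: le_trans (_ : \sum_(s < N)
    ((s == (i %% N)%N :> nat)%:R + (s == (i.+1 %% N)%N :> nat)%:R) <= _); last first.
  by rewrite big_split /=; apply: lerD (ind1 _) (ind1 _).
apply: ler_sum => s _.
have le1 : 1 - \sum_(l < M.+2) cell N s l y ^+ 2 <= 1.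
  by rewrite gerBl; apply: sumr_ge0 => l _; rewrite exprn_ge0// trapezoid_ge0.
case: eqVneq => [_|si]; first by rewrite (le_trans le1)// lerDl.
case: eqVneq => [_|si1]; first by rewrite add0r.
have sN := ltn_ord s.
(* [l] is the cell that contains [y], and the remainder [r] is the position of [i] in it. Adding [N]
   keeps the subtraction exact, since s < N. The two excluded congruences say that r is neither 0
   nor N - 1, which places [y] on the plateau. *)
pose l := ((i + N - s) %/ N)%N.
have ldef : (i + N - s = l * N + (i + N - s) %% N)%N by exact: divn_eq.
have rN : ((i + N - s) %% N < N)%N by rewrite ltn_mod.
set r := ((i + N - s) %% N)%N in ldef rN.
have sir : (s + r = i %[mod N])%N.
  have : (i + N = s + r + l * N)%N by lia.
  by move=> /(congr1 (modn^~ N)); rewrite modnDr addnC modnMDl => ->.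
have r0 : (0 < r)%N.
  rewrite lt0n; apply/eqP => r0; move: si; rewrite -sir r0 addn0 modn_small//.
  by rewrite eqxx.
have rN1 : (r.+1 < N)%N.
  rewrite ltn_neqAle rN andbT; apply/eqP => rN1; move: si1.
  by rewrite -addn1 -modnDml -sir modnDml -addnA addn1 rN1 modnDr modn_small ?eqxx.
(* From i <= M and N >= 1 follows l <= M + 1: hence [M.+2] cells. *)
have lM : (l < M.+2)%N by rewrite ltnS; rewrite /l; nia.
rewrite !mulr0n addr0 subr_le0.
have ly : cell N s l y = 1.
  have e1 : (i%:R : R) + N%:R = s%:R + l%:R * N%:R + r%:R.
    by rewrite -natrM -!natrD; congr (_%:R); lia.
  have e2 : (1 : R) <= r%:R by rewrite ler1n.
  have e3 : r%:R + 2 <= N%:R :> R by rewrite -natrD ler_nat; lia.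
  apply: trapezoid_eq1; first by lra.
  by move: yi; rewrite -natr1; lra.
rewrite (bigD1 (Ordinal lM))//= ly expr1n lerDl.
by apply: sumr_ge0 => k _; rewrite exprn_ge0// trapezoid_ge0.
Qed.

(** An analogue of the union bound, by induction from 1 - a p = (1 - a) + a (1 - p); the induction
    also carries that the product lies in [0, 1]. *)
Lemma one_minus_prod_le (I : Type) (r : seq I) (a : I -> R) :
  (forall i, 0 <= a i <= 1) -> 1 - \prod_(i <- r) a i <= \sum_(i <- r) (1 - a i).
Proof.
move=> a01; suff /andP[] : (0 <= \prod_(i <- r) a i <= 1) &&
  (1 - \prod_(i <- r) a i <= \sum_(i <- r) (1 - a i)) by [].
elim: r => [|i r /andP[/andP[p0 p1] IH]]; first by rewrite !big_nil subrr !lexx ler01.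
rewrite !big_cons; have /andP[a0 a1] := a01 i.
rewrite mulr_ge0//= mulr_ile1//=; nra.
Qed.

Section Grid.
Context {D : finType} {K : Type} {h : D -> K -> R} {N M : nat}.
Hypothesis N_gt0 : (0 < N)%N.
Hypothesis hM : forall i t, 0 <= h i t <= M%:R.

Definition grid (s : 'I_N) (j : {ffun D -> 'I_M.+2}) (t : K) : R :=
  \prod_i cell N s (j i) (h i t).

Lemma grid_ge0 (s : 'I_N) j t : 0 <= grid s j t.
Proof. by apply: prodr_ge0 => i _; exact: trapezoid_ge0. Qed.

Lemma grid_le1 (s : 'I_N) j t : grid s j t <= 1.
Proof.
by apply: prodr_ile1 => i _; rewrite trapezoid_ge0 trapezoid_le1.
Qed.

Lemma grid_disjoint (s : 'I_N) j j' t : j != j' -> grid s j t * grid s j' t = 0.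
Proof.
move=> jj'; have [i ji] : exists i, j i != j' i.
  by apply/existsP; apply: contraNT jj' => /existsPn h'; apply/eqP/ffunP => i;
    apply/eqP; have := h' i; rewrite negbK.
by rewrite /grid -big_split (bigD1 i)//= cell_disjoint ?mul0r.
Qed.

(** All factors of a nonzero product are nonzero, so both values lie in one open interval of length
    [N]. *)
Lemma grid_oscillation (s : 'I_N) j t t' i : grid s j t != 0 -> grid s j t' != 0 ->
  `|h i t - h i t'| <= N%:R.
Proof.
move=> /prodf_neq0/(_ i isT)/trapezoid_neq0/andP[h1 h2].
move=> /prodf_neq0/(_ i isT)/trapezoid_neq0/andP[h3 h4].
by rewrite ler_norml; apply/andP; split; lra.
Qed.

Lemma grid_residual_ge0 (s : 'I_N) t : 0 <= 1 - \sum_j grid s j t ^+ 2.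
Proof.
rewrite subr_ge0; under eq_bigr do rewrite -[_ ^+ 2]mulr1.
apply: disjoint_weighted_le => // [j|j j']; last exact: grid_disjoint.
by rewrite grid_ge0 grid_le1.
Qed.

(** The sum over all boxes [j] factors into a product over the coordinates. The union bound then
    leaves a residual of at most 2 per coordinate. *)
Lemma grid_residual t :
  \sum_(s < N) (1 - \sum_j grid s j t ^+ 2) <= (2 * #|D|)%:R.
Proof.
have cell01 (s : 'I_N) i : 0 <= \sum_(l < M.+2) cell N s l (h i t) ^+ 2 <= 1.
  rewrite sumr_ge0/=; last by move=> l _; rewrite exprn_ge0// trapezoid_ge0.
  under eq_bigr do rewrite -[_ ^+ 2]mulr1.
  apply: disjoint_weighted_le => // [l|l l'].
    by rewrite trapezoid_ge0 trapezoid_le1.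
  exact: cell_disjoint.
apply: le_trans (_ : \sum_(s < N) \sum_i
    (1 - \sum_(l < M.+2) cell N s l (h i t) ^+ 2) <= _).
  apply: ler_sum => s _; rewrite (_ : \sum_j _ =
      \prod_i \sum_(l < M.+2) cell N s l (h i t) ^+ 2).
    exact: one_minus_prod_le.
  by rewrite bigA_distr_bigA; apply: eq_bigr => j _; rewrite -prodrXl.
rewrite exchange_big /= mulnC natrM -sum1_card natr_sum mulr_suml.
by apply: ler_sum => i _; rewrite mul1r; exact: cell_residual.
Qed.

End Grid.
End Trapezoid.

(** * Continuous disjoint systems of small oscillation *)

Section ContinuousSystems.
Context {R : realType}.

Lemma rnorm_complexE (z : R[i]) :
  rnorm (z : R[i]^o) = Num.sqrt (complex.Re z ^+ 2 + complex.Im z ^+ 2).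
Proof. by rewrite /rnorm -[`|_|]/(`|z|) normc_def. Qed.

Lemma ler_rnorm_Re (z : R[i]) : `|complex.Re z| <= rnorm (z : R[i]^o).
Proof.
by rewrite rnorm_complexE -sqrtr_sqr; apply: ler_wsqrtr; rewrite lerDl sqr_ge0.
Qed.

Lemma ler_rnorm_Im (z : R[i]) : `|complex.Im z| <= rnorm (z : R[i]^o).
Proof.
by rewrite rnorm_complexE -sqrtr_sqr; apply: ler_wsqrtr; rewrite lerDr sqr_ge0.
Qed.

Lemma rnorm_complex_le (z : R[i]) :
  rnorm (z : R[i]^o) <= `|complex.Re z| + `|complex.Im z|.
Proof.
rewrite rnorm_complexE -[leRHS]ger0_norm ?addr_ge0// -sqrtr_sqr.
apply: ler_wsqrtr; rewrite sqrrD !real_normK ?num_real// lerD2r lerDl.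
by rewrite mulrn_wge0// mulr_ge0.
Qed.

Lemma rnormM (a b : R[i]) :
  rnorm (a * b : R[i]^o) = rnorm (a : R[i]^o) * rnorm (b : R[i]^o).
Proof. exact: (@rnormZ R R[i]^o). Qed.

Context {K : topologicalType}.

Lemma continuous_complex_real (f : K -> R[i]^o) (phi : R[i] -> R) :
  (forall z z', `|phi z - phi z'| <= rnorm (z - z' : R[i]^o)) ->
  continuous f -> continuous (fun t => phi (f t) : R).
Proof.
move=> phi_le fc t; apply/cvgrPdist_lt => e e0.
have e0' : 0 < e%:C :> R[i] by rewrite ltcR.
have /cvgrPdist_lt/(_ _ e0') := fc t; apply: filterS => s fts.
apply: le_lt_trans (phi_le _ _) _.
by rewrite -ltcR -rnormE.
Qed.

Lemma continuous_real_complex (g : K -> R) : continuous g ->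
  continuous (fun t => (g t)%:C : R[i]^o).
Proof.
move=> gc t; apply/cvgrPdist_lt => e e0.
(* A positive element of [R[i]] is real. *)
have eE : e = (complex.Re e)%:C by rewrite RRe_real// gtr0_real.
have e0' : 0 < complex.Re e by rewrite -ltcR -eE.
have /cvgrPdist_lt/(_ _ e0') := gc t; apply: filterS => s gts.
rewrite eE -rmorphB rnormE ltcR; apply: le_lt_trans gts.
apply: le_trans (rnorm_complex_le _) _.
by rewrite /= normr0 addr0.
Qed.

Lemma continuous_trapezoid N a (g : K -> R) : continuous g ->
  continuous (fun t => trapezoid N a (g t)).
Proof.
move=> gc.
have ac x : continuous (fun _ : K => x : R) by move=> t; exact: cvg_cst.
have := max_fun_continuous (ac 0) (min_fun_continuous (ac 1)
  (min_fun_continuous (f := fun t => g t - a) (g := fun t => a + N%:R - g t) _ _)).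
apply=> t.
  by apply: cvgB; [exact: gc | exact: cvg_cst].
by apply: cvgB; [exact: cvg_cst | exact: gc].
Qed.

Lemma continuous_grid (D : finType) (h : D -> K -> R) N M s j :
  (forall i, continuous (h i)) -> continuous (@grid R D K h N M s j).
Proof.
move=> hc t; apply: cvg_big => [|i _]; first exact: mul_continuous.
by apply: continuous_trapezoid.
Qed.

Context {cK : compact [set: K]}.

Definition CK_of_real (g : K -> R) (gc : continuous g) : CK R cK :=
  MkCK cK (introT (asboolP _) (continuous_real_complex _ gc)).

(** The grids are applied to the 2n real and imaginary parts of the [f k]; a residual of 2 per
    coordinate gives the constant 4n. *)
Lemma shifted_systems (n : nat) (f : 'I_n -> CK R cK) (N : nat) : (0 < N)%N ->
  exists (J : finType) (psi : 'I_N -> J -> CK R cK),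
  [/\ forall s j t, rnorm (psi s j t) <= 1,
      forall s j j', j != j' -> psi s j * psi s j' = 0,
      forall s j k t t', psi s j t != 0 -> psi s j t' != 0 ->
        rnorm (f k t - f k t') <= 2 / N%:R &
      forall t, rnorm ((\sum_(s < N) (1 - \sum_j psi s j * psi s j)) t) <=
        (4 * n)%:R].
Proof.
move=> N0; pose D := ('I_n * bool)%type.
pose B : R := \sum_(k < n) rnorm (f k).
pose coord (b : bool) (z : R[i]) := if b then complex.Re z else complex.Im z.
have coord_le b z : `|coord b z| <= rnorm (z : R[i]^o).
  by case: b; [exact: ler_rnorm_Re | exact: ler_rnorm_Im].
have coordB b z z' : coord b (z - z') = coord b z - coord b z'.
  by case: b; rewrite /coord raddfB.
have fB k t b : `|coord b (f k t)| <= B.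
  apply: le_trans (coord_le _ _) _; apply: le_trans (le_sup_norm (f k) t) _.
  rewrite /B (bigD1 k)//= lerDl; apply: sumr_ge0 => i _; exact: rnorm_ge0.
have N0' : 0 < N%:R :> R by rewrite ltr0n.
(* Adding [B] makes the coordinates nonnegative. The factor N^2 turns a cell of length N into an
   oscillation 1/N of each coordinate, hence at most 2/N for the complex value. *)
pose h (i : D) (t : K) : R := (coord i.2 (f i.1 t) + B) * N%:R ^+ 2.
pose M := (Num.truncn (2 * B * N%:R ^+ 2)).+1.
have hM i t : 0 <= h i t <= M%:R.
  have := fB i.1 t i.2; rewrite ler_norml => /andP[h1 h2].
  rewrite mulr_ge0 ?exprn_ge0//=; last by lra.
  apply: le_trans (_ : 2 * B * N%:R ^+ 2 <= _); last by rewrite ltW// truncnS_gt.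
  by rewrite ler_wpM2r ?exprn_ge0//; lra.
have hc i : continuous (h i).
  move=> t; apply: cvgM; last exact: cvg_cst.
  apply: cvgD; last exact: cvg_cst.
  apply: (continuous_complex_real _ (coord i.2)) (@CK_continuous _ _ _ (f i.1)) t => z z'.
  by rewrite -coordB.
pose psi s j := CK_of_real _ (@continuous_grid D h N M s j hc).
exists {ffun D -> 'I_M.+2}, psi; split.
- by move=> s j t; rewrite rnorm_real ?grid_ge0// grid_le1.
- move=> s j j' jj'; apply/val_inj/funext => t.
  rewrite -[LHS]/((grid s j t)%:C * (grid s j' t)%:C : R[i]).
  by rewrite -rmorphM /= grid_disjoint.
- move=> s j k t t' jt jt'.
  have g0 t1 : psi s j t1 != 0 -> grid (h := h) s j t1 != 0.
    by apply: contraNneq => g0; rewrite -[_ t1]/((grid s j t1)%:C) g0.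
  have osc b : `|coord b (f k t - f k t')| <= N%:R^-1.
    have := @grid_oscillation R D K h N M s j t t' (k, b) (g0 _ jt) (g0 _ jt').
    rewrite /h /= -mulrBl opprD addrACA subrr addr0 -coordB normrM (ger0_norm (exprn_ge0 _ (ltW N0'))).
    by rewrite expr2 mulrA -ler_pdivlMr// divff ?lt0r_neq0// -ler_pdivlMr// div1r.
  apply: le_trans (rnorm_complex_le _) _.
  by have := osc true; have := osc false; rewrite /coord; lra.
- move=> t; rewrite (_ : (_ : CK R cK) t =
      (\sum_(s < N) (1 - \sum_j grid (h := h) (M := M) s j t ^+ 2))%:C).
    rewrite rnorm_real; last by apply: sumr_ge0 => s _; exact: grid_residual_ge0.
    apply: le_trans (grid_residual N0 hM t) _.
    by rewrite card_prod card_ord card_bool ler_nat; lia.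
  rewrite CK_sumE rmorph_sum; apply: eq_bigr => s _ /=.
  rewrite rmorphB rmorph_sum /=; congr (_ - _); rewrite CK_sumE.
  by apply: eq_bigr => j _; rewrite rmorphXn.
Qed.

End ContinuousSystems.

(** * The bound on the algebraic tensor product *)

Lemma rnormMn {R : realType} {V : normedModType R[i]} (x : V) n :
  rnorm (x *+ n) = rnorm x *+ n.
Proof. by apply: complexI; rewrite -rnormE normrMn rmorphMn /= -rnormE. Qed.

Section PartOne.
Context {R : realType} {d : measure_display} {Omega : measurableType d}.
Context {P : probability Omega R} {eps : nat -> {RV P >-> R}}.
Hypothesis heps : rademacher_sequence eps.
Context {K : topologicalType} {cK : compact [set: K]}.
Context {X : normedModType R[i]}.
Context {u : {linear CK R cK -> BX X}}.
Hypothesis ub : bounded_map u.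
Hypothesis uM : forall f g : CK R cK, u (f * g) = u f * u g.
Context {n : nat} {f : 'I_n -> CK R cK} {b : 'I_n -> BX X}.
Hypothesis bcomm : forall k, commutant u (b k).

Lemma rnorm_sum_u_le (g : 'I_n -> CK R cK) (c : 'I_n -> R) :
  (forall k, 0 <= c k) -> (forall k t, rnorm (g k t) <= c k) ->
  rnorm (\sum_(k < n) u (g k) * b k) <=
    opnorm u * \sum_(k < n) c k * rnorm (b k).
Proof.
move=> c0 gc; apply: le_trans (rnorm_sum _ _ _ _) _; rewrite mulr_sumr.
apply: ler_sum => k _; apply: le_trans (BX_rnormM _ _) _; rewrite mulrA.
by rewrite ler_wpM2r ?rnorm_ge0//; exact: (rnorm_u_le ub).
Qed.

(* Replacing [f k] on the support of [psi j] by its value at one point of that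
   support turns the sum into [\sum_j u (psi j ^ 2) F(t_j)], up to [delta]. *)
Lemma disjoint_tensor_bound {c delta : R} {J : finType} {psi : J -> CK R cK} :
  R_bounded_by eps (range (tensor_fun f b)) c -> 0 <= delta ->
  (forall j t, rnorm (psi j t) <= 1) ->
  (forall i j, i != j -> psi i * psi j = 0) ->
  (forall j k t t', psi j t != 0 -> psi j t' != 0 ->
    rnorm (f k t - f k t') <= delta) ->
  rnorm (\sum_(k < n) u ((\sum_j psi j * psi j) * f k) * b k) <=
    opnorm u ^+ 2 * c + opnorm u * \sum_(k < n) delta * rnorm (b k).
Proof.
move=> Rc delta0 psi1 psi_disj osc.
(* If [K] is empty, there is no point to sample at, but then C(K) is zero. *)
have [[t0 _]|K0] := pselect (exists t : K, True); last first.
  rewrite (_ : \sum_(k < n) _ = 0); last first.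
    rewrite big1// => k _; rewrite (_ : _ * f k = 0) ?linear0 ?mul0r//.
    by apply/val_inj/funext => t; case: K0; exists t.
  rewrite rnorm0 addr_ge0 ?mulr_ge0 ?exprn_ge0 ?opnorm_ge0//; first by case: Rc.
  by apply: sumr_ge0 => k _; rewrite mulr_ge0 ?rnorm_ge0.
(* The default [t0] is taken only when [psi j] vanishes identically, and then the corresponding term
   is zero. *)
pose tt j := xget t0 [set t | psi j t != 0].
have ttP j t : psi j t != 0 -> psi j (tt j) != 0.
  by move=> jt; rewrite /tt; case: xgetP => [s -> //|/(_ t)].
pose T j := tensor_fun f b (tt j).
have Tcomm j : commutant u (T j).
  move=> g; rewrite /T /tensor_fun mulr_suml mulr_sumr; apply: eq_bigr => k _.
  by rewrite BX_scalerAl BX_scalerAr bcomm.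
pose e k : CK R cK :=
  (\sum_j psi j * psi j) * f k - \sum_j (f k (tt j) : R[i]) *: (psi j * psi j).
have eE k t : e k t = \sum_j (psi j t : R[i]) ^+ 2 * (f k t - f k (tt j)) :> R[i].
  rewrite /e CK_subE CK_mulE !CK_sumE mulr_suml -sumrB.
  by apply: eq_bigr => j _; rewrite CK_scaleE CK_mulE mulrBr [_ * f k (tt j)]mulrC.
have e_le k t : rnorm (e k t) <= delta.
  rewrite eE; apply: le_trans (rnorm_sum _ _ _ _) _.
  under eq_bigr do rewrite rnormM expr2 rnormM -expr2.
  apply: disjoint_weighted_le => // [j|i j ij|j jt].
  - by rewrite rnorm_ge0 psi1.
  - by rewrite -rnormM -CK_mulE psi_disj// rnorm0.
  - have jt0 : psi j t != 0 by apply: contraNneq jt => ->; rewrite rnorm0.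
    exact: osc jt0 (ttP _ _ jt0).
rewrite (_ : \sum_(k < n) _ =
  \sum_j u (psi j * psi j) * T j + \sum_(k < n) u (e k) * b k); last first.
  under [X in _ + X]eq_bigr do rewrite linearB mulrBl.
  rewrite sumrB addrC -[LHS]addr0 -addrA; congr (_ + _).
  apply/esym/eqP; rewrite addrC subr_eq0; apply/eqP.
  under eq_bigr do rewrite mulr_sumr.
  rewrite exchange_big; apply: eq_bigr => k _; rewrite linear_sum mulr_suml.
  by apply: eq_bigr => j _; rewrite linearZ BX_scalerAl BX_scalerAr.
apply: le_trans (ler_rnormD _ _) (lerD _ _); last exact: rnorm_sum_u_le.
(* R-boundedness speaks of families indexed by ordinals, so [J] is enumerated. *)
rewrite (reindex _ (onW_bij _ (@enum_val_bij J))) /=.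
apply: (disjoint_sum_bound heps ub uM Rc) => // i j ij.
by apply: psi_disj; rewrite (inj_eq enum_val_inj).
Qed.

(** Summing the decompositions for all N shifts gives N |S| <= N |u|^2 c + C with [C] independent of
    N; letting N grow removes [C]. *)
Lemma tensor_bound {c : R} : R_bounded_by eps (range (tensor_fun f b)) c ->
  rnorm (\sum_(k < n) u (f k) * b k) <= opnorm u ^+ 2 * c.
Proof.
move=> Rc; set S := \sum_(k < n) _.
(* The first term is N times the oscillation error of size 2/N, the second comes from the total
   remainder, bounded by 4n. *)
pose C := opnorm u * \sum_(k < n) 2 * rnorm (b k) +
  opnorm u * \sum_(k < n) ((4 * n)%:R * sup_norm (f k)) * rnorm (b k).
suff key (N : nat) : (0 < N)%N -> (rnorm S - opnorm u ^+ 2 * c) * N%:R <= C.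
  rewrite leNgt; apply/negP; rewrite -subr_gt0 => x0.
  have := key (Num.truncn (C / (rnorm S - opnorm u ^+ 2 * c))).+1 (ltn0Sn _).
  by apply/negP; rewrite -ltNge mulrC -ltr_pdivrMr// truncnS_gt.
move=> N0; have N0' : 0 < N%:R :> R by rewrite ltr0n.
have [J [psi [psi1 psi_disj osc resid]]] := shifted_systems _ f _ N0.
pose q s : CK R cK := \sum_j psi s j * psi s j.
(* Each copy of [S] is split along 1 = q s + (1 - q s). The remainders are added up before [u] is
   applied, since only their sum has a bound free of N. *)
have SE : S *+ N = \sum_(s < N) \sum_(k < n) u (q s * f k) * b k +
    \sum_(k < n) u ((\sum_(s < N) (1 - q s)) * f k) * b k.
  rewrite exchange_big -big_split /= -sumrMnl; apply: eq_bigr => k _.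
  rewrite mulr_suml linear_sum !mulr_suml -big_split /=.
  rewrite -[LHS]mulr1n -[in LHS](card_ord N) -sumr_const; apply: eq_bigr => s _.
  by rewrite -mulrDl -linearD -mulrDl addrC subrK mul1r.
have le1 s : rnorm (\sum_(k < n) u (q s * f k) * b k) <=
    opnorm u ^+ 2 * c + opnorm u * \sum_(k < n) (2 / N%:R) * rnorm (b k).
  apply: (disjoint_tensor_bound Rc _ (psi1 s) (psi_disj s) (osc s)).
  by rewrite divr_ge0.
have le2 : rnorm (\sum_(k < n) u ((\sum_(s < N) (1 - q s)) * f k) * b k) <=
    opnorm u * \sum_(k < n) ((4 * n)%:R * sup_norm (f k)) * rnorm (b k).
  apply: rnorm_sum_u_le => [k|k t]; first by rewrite mulr_ge0 ?sup_norm_ge0.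
  rewrite CK_mulE rnormM; apply: ler_pM; rewrite ?rnorm_ge0//.
  exact: le_sup_norm.
have : rnorm (S *+ N) <= (opnorm u ^+ 2 * c +
    opnorm u * \sum_(k < n) (2 / N%:R) * rnorm (b k)) *+ N +
    opnorm u * \sum_(k < n) ((4 * n)%:R * sup_norm (f k)) * rnorm (b k).
  rewrite SE; apply: le_trans (ler_rnormD _ _) (lerD _ le2).
  apply: le_trans (rnorm_sum _ _ _ _) _.
  apply: le_trans (ler_sum _ (fun s _ => le1 s)) _.
  by rewrite sumr_const card_ord.
rewrite rnormMn -(mulr_natr (rnorm S)) -(mulr_natr (_ + _)) (mulrDl (_ * c)).
have -> : opnorm u * (\sum_(k < n) 2 / N%:R * rnorm (b k)) * N%:R =
    opnorm u * \sum_(k < n) 2 * rnorm (b k).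
  rewrite -mulrA mulr_suml; congr (_ * _); apply: eq_bigr => k _.
  by rewrite mulrAC divfK// lt0r_neq0.
by rewrite mulrBl lerBlDl -addrA.
Qed.

End PartOne.

(** * Extension to the completion *)

Section DenseExtension.
Context {R : realType} {V : lmodType R[i]} {Z : normedModType R[i]}.
Context {i : {linear V -> Z}}.
Hypothesis i_dense : dense (range i).

Lemma dense_range_approx z (e : R) : 0 < e -> exists v, rnorm (i v - z) < e.
Proof.
move=> e0; have e0' : 0 < e%:C :> R[i] by rewrite ltcR.
have [x [zx [v _ vx]]] := i_dense (ball z e%:C)
  (ex_intro _ z (ballxx z e0')) (ball_open z e%:C).
exists v; rewrite vx -ltcR -rnormE -normrN opprB.
by move: zx; rewrite -ball_normE.
Qed.

Lemma bounded_linear_eq0 {Y : normedModType R[i]} (W : Z -> Y) :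
  linear W -> bounded_map W -> (forall v, W (i v) = 0) -> forall z, W z = 0.
Proof.
move=> Wl [M WM] Wi z; apply/rnorm_eq0/le_anti; rewrite rnorm_ge0 andbT.
apply/ler_addgt0Pr => e e0; rewrite add0r.
(* [M] may be zero or negative, so a positive constant replaces it before dividing. *)
have M0 : 0 < `|M| + 1 by rewrite ltr_wpDl.
have [v vz] := dense_range_approx z (e / (`|M| + 1)) (divr_gt0 e0 M0).
have WE : W (i v - z) = - W z.
  by have := Wl (-1) z (i v); rewrite Wi addr0 !scaleN1r addrC.
rewrite -rnormN -WE; apply: le_trans (WM _) _.
apply: le_trans (_ : (`|M| + 1) * rnorm (i v - z) <= _).
  by rewrite ler_wpM2r ?rnorm_ge0// (le_trans (ler_norm M))// lerDl.
by rewrite mulrC -ler_pdivlMr// ltW.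
Qed.

Context {Y : completeNormedModType R[i]}.

(** The bound, measured through [i], passes to the closure of the graph. With linearity it makes the
    value unique; completeness of [Y] makes it exist. *)
Lemma dense_extension (w : V -> Y) (C : R) : 0 <= C -> linear w ->
  (forall v, rnorm (w v) <= C * rnorm (i v)) ->
  exists W : Z -> Y, [/\ linear W, forall v, W (i v) = w v &
    forall z, rnorm (W z) <= C * rnorm z].
Proof.
move=> C0 wl wC.
have wB v v' : w (v - v') = w v - w v'.
  by rewrite -[v - v']addrC -scaleN1r wl scaleN1r addrC.
(* the closure of the graph of [i v |-> w v] *)
pose Q z y := forall e : R, 0 < e ->
  exists v, rnorm (i v - z) <= e /\ rnorm (w v - y) <= e.
have Q_linear a z z' y y' : Q z y -> Q z' y' -> Q (a *: z + z') (a *: y + y').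
  move=> zy zy' e e0; have a0 := rnorm_ge0 (a : R[i]^o).
  have a1 : 0 < rnorm (a : R[i]^o) + 1 by rewrite ltr_wpDl.
  have d0 := divr_gt0 e0 a1; set dd := e / _ in d0.
  have dE : rnorm (a : R[i]^o) * dd + dd = e.
    by rewrite -[X in _ + X]mul1r -mulrDl mulrC divfK// lt0r_neq0.
  have [v [v1 v2]] := zy _ d0; have [v' [v1' v2']] := zy' _ d0.
  exists (a *: v + v'); rewrite -dE; split.
    rewrite linearP opprD addrACA -scalerBr; apply: le_trans (ler_rnormD _ _) _.
    by rewrite rnormZ lerD// ler_wpM2l.
  rewrite wl opprD addrACA -scalerBr; apply: le_trans (ler_rnormD _ _) _.
  by rewrite rnormZ lerD// ler_wpM2l.
have Q_bound z y : Q z y -> rnorm y <= C * rnorm z.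
  move=> zy; apply/ler_addgt0Pr => e e0.
  have C1 : 0 < C + 1 by rewrite ltr_wpDl.
  have [v [v1 v2]] := zy _ (divr_gt0 e0 C1); set dd := e / _ in v1 v2.
  have dE : C * dd + dd = e.
    by rewrite -[X in _ + X]mul1r -mulrDl mulrC divfK// lt0r_neq0.
  have h1 : rnorm y <= rnorm (w v) + rnorm (w v - y).
    by rewrite -(rnormN (w v - y)); apply: le_trans (ler_rnormD _ _); rewrite subKr.
  have h2 : rnorm (i v) <= rnorm z + rnorm (i v - z).
    by apply: le_trans (ler_rnormD _ _); rewrite addrC subrK.
  have h3 := wC v.
  have h4 : C * rnorm (i v) <= C * (rnorm z + dd) by rewrite ler_wpM2l//; lra.
  by rewrite mulrDr in h4; lra.
have Q_uniq z y y' : Q z y -> Q z y' -> y = y'.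
  move=> zy zy'; have := Q_bound _ _ (Q_linear (-1) _ _ _ _ zy zy').
  rewrite !scaleN1r addNr rnorm0 mulr0 => h.
  by apply/esym/eqP; rewrite -subr_eq0 addrC; apply/eqP/rnorm_eq0/le_anti;
    rewrite rnorm_ge0 h.
have Q_i v : Q (i v) (w v).
  by move=> e e0; exists v; rewrite !subrr !rnorm0 ltW.
(* The images of points [i (v n)] converging to [z] form a Cauchy sequence by the bound on [w]. *)
have Q_ex z : exists y, Q z y.
  have /choice[v vz] : forall n : nat, exists v, rnorm (i v - z) < n.+1%:R^-1.
    by move=> n; apply: dense_range_approx; rewrite invr_gt0.
  have inv_lt (e : R) : 0 < e -> \forall n \near \oo, n.+1%:R^-1 < e.
    move=> e0; have := near_infty_natSinv_lt (PosNum e0).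
    exact: filterS.
  have wv_cvg : cvg (w (v n) @[n --> \oo]).
    apply/cauchy_cvgP/cauchy_exP => e e0.
    have eE : e = (complex.Re e)%:C by rewrite RRe_real// gtr0_real.
    have e0' : 0 < complex.Re e by rewrite -ltcR -eE.
    have C1 : 0 < 2 * (C + 1) by rewrite mulr_gt0// ltr_wpDl.
    have near_e := inv_lt _ (divr_gt0 e0' C1).
    set dd := _ / _ in near_e.
    have dE : C * (dd + dd) + (dd + dd) = complex.Re e.
      by rewrite /dd; field; rewrite lt0r_neq0// ltr_wpDl.
    have [m _ mP] := near_e.
    exists (w (v m)); exists m => // n /= mn.
    rewrite -ball_normE /= eE rnormE ltcR -wB; apply: le_lt_trans (wC _) _.
    rewrite linearB.
    have h1 : rnorm (i (v m) - i (v n)) < dd + dd.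
      rewrite -(subrK z (i (v m))) -addrA; apply: le_lt_trans (ler_rnormD _ _) _.
      rewrite -(rnormN (z - _)) opprB.
      apply: ltrD; [apply: lt_trans (vz m) _ | apply: lt_trans (vz n) _];
        by apply: mP => /=.
    have h2 : C * rnorm (i (v m) - i (v n)) <= C * (dd + dd).
      by rewrite ler_wpM2l// ltW.
    have := rnorm_ge0 (i (v m) - i (v n)); lra.
  exists (lim (w (v n) @[n --> \oo])) => e e0.
  have e0' : 0 < e%:C :> R[i] by rewrite ltcR.
  have /cvgrPdist_lt/(_ _ e0') wv_lim := wv_cvg.
  have [n [n1 n2]] := filter_ex (filterI wv_lim (inv_lt _ e0)).
  exists (v n); split; first by rewrite ltW// (lt_trans (vz n)).
  by rewrite -rnormN opprB ltW// -ltcR -rnormE.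
have /choice[W WP] := Q_ex.
exists W; split.
- by move=> a z z'; apply: Q_uniq (WP _) (Q_linear _ _ _ _ _ (WP z) (WP z')).
- by move=> v; apply: Q_uniq (WP _) (Q_i v).
- by move=> z; apply: Q_bound.
Qed.

End DenseExtension.

(** * Tensors and the images of their representations *)

Section CommutantRepresentation.
Context {R : realType} {K : topologicalType} {cK : compact [set: K]}.
Context {X : normedModType R[i]}.
Context (u : {linear CK R cK -> BX X}).

(** A relation, because a tensor has many representations; that [S] depends on [F] alone will follow
    from the norm estimate. *)
Definition tensor_image (F : tensor cK (commutant u)) (S : BX X) : Prop :=
  exists (n : nat) (f : 'I_n -> CK R cK) (b : 'I_n -> BX X),
    [/\ forall k, commutant u (b k), tensor_val F = tensor_fun f b &
        S = \sum_(k < n) u (f k) * b k].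

Lemma tensor_image_ex F : exists S, tensor_image F S.
Proof.
have /asboolP[n [f [b [bcomm FE]]]] := tensor_valP F.
by exists (\sum_(k < n) u (f k) * b k), n, f, b.
Qed.

Lemma tensor_image_linear a F G S T : tensor_image F S -> tensor_image G T ->
  tensor_image (a *: F + G) (a *: S + T).
Proof.
move=> [m [f [b [bcomm FE ->]]]] [n [g [c [ccomm GE ->]]]].
exists (m + n)%N,
  (fun k => match fintype.split k with inl i => a *: f i | inr j => g j end),
  (fun k => match fintype.split k with inl i => b i | inr j => c j end).
have splitl k : fintype.split (lshift n k) = inl k := unsplitK (inl k).
have splitr k : fintype.split (rshift m k) = inr k := unsplitK (inr k).
split=> [k||]; first by case: fintype.splitP.
- apply/funext => t; rewrite /tensor_fun big_split_ord /=.
  rewrite -[LHS]/(a *: (tensor_val F t) + tensor_val G t) FE GE /tensor_fun.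
  rewrite scaler_sumr; congr (_ + _); apply: eq_bigr => k _.
    by rewrite splitl CK_scaleE scalerA.
  by rewrite splitr.
- rewrite big_split_ord /= scaler_sumr; congr (_ + _); apply: eq_bigr => k _.
    by rewrite splitl linearZ BX_scalerAl.
  by rewrite splitr.
Qed.

Lemma tensor_image_pure f b (hb : commutant u b) :
  tensor_image (pure_tensor f hb) (u f * b).
Proof.
exists 1%N, (fun=> f), (fun=> b); split=> //; last first.
  by rewrite big_ord_recl big_ord0 addr0.
by apply/funext => t; rewrite /tensor_fun big_ord_recl big_ord0 addr0.
Qed.

(** Serves the uniqueness of the extension: a linear map is determined on tensors by its values on
    pure ones. *)
Lemma tensor_sum_pure F : exists n (f : 'I_n -> CK R cK) (b : 'I_n -> BX X)
    (hb : forall k, commutant u (b k)),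
  F = \sum_(k < n) pure_tensor (f k) (hb k).
Proof.
have /asboolP[n [f [b [bcomm FE]]]] := tensor_valP F.
exists n, f, b, bcomm; apply/val_inj/funext => t /=; rewrite FE.
have -> : forall (r : seq 'I_n), tensor_val (\sum_(k <- r) pure_tensor (f k) (bcomm k)) t =
    \sum_(k <- r) (f k t : R[i]) *: b k by move=> r; elim/big_rec2 : _ => // k y1 y2 _ <-.
by [].
Qed.

End CommutantRepresentation.

Section NormR.
Context {R : realType} {d : measure_display} {Omega : measurableType d}.
Context {P : probability Omega R} {eps : nat -> {RV P >-> R}}.
Hypothesis heps : rademacher_sequence eps.
Context {K : topologicalType} {cK : compact [set: K]}.
Context {X : normedModType R[i]}.
Context {u : {linear CK R cK -> BX X}}.
Hypothesis ub : bounded_map u.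
Hypothesis uM : forall f g : CK R cK, u (f * g) = u f * u g.

(* When [u = 0] the right-hand side may be [0 * +oo], which is [0]. *)
Lemma rnorm_le_norm_R n (f : 'I_n -> CK R cK) (b : 'I_n -> BX X) :
  (forall k, commutant u (b k)) ->
  ((rnorm (\sum_(k < n) u (f k) * b k))%:E <=
    ((opnorm u) ^+ 2)%:E * norm_R eps (tensor_fun f b))%E.
Proof.
move=> bcomm; have [u0|u0] := eqVneq (opnorm u) 0.
  rewrite big1 ?rnorm0 ?u0 ?expr0n ?mul0e// => k _.
  rewrite (_ : u (f k) = 0) ?mul0r//; apply/rnorm_eq0/le_anti.
  by rewrite rnorm_ge0 andbT (le_trans (rnorm_u ub _))// u0 mul0r.
have u2 : 0 < opnorm u ^+ 2 by rewrite exprn_gt0// lt_neqAle eq_sym u0 opnorm_ge0.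
set S := \sum_(k < n) _.
(* Dividing by |u|^2 reduces the claim to a lower bound for the infimum defining [norm_R]. *)
rewrite (_ : (rnorm S)%:E =
    ((opnorm u ^+ 2)%:E * ((opnorm u ^+ 2)^-1 * rnorm S)%:E)%E); last first.
  by rewrite -EFinM mulrA divff ?mul1r// lt0r_neq0.
apply: lee_wpmul2l; first by rewrite lee_fin ltW.
apply: le_ereal_inf_tmp => _ [c Rc <-]; rewrite lee_fin ler_pdivrMl//.
exact: (tensor_bound heps ub uM bcomm Rc).
Qed.

Context {Z : completeNormedModType R[i]}.
Context {i : {linear tensor cK (commutant u) -> Z}}.
Hypothesis i_isom : forall F, (rnorm (i F))%:E = norm_R eps F.

Lemma tensor_image_bound F S : tensor_image u F S ->
  rnorm S <= opnorm u ^+ 2 * rnorm (i F).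
Proof.
move=> [n [f [b [bcomm FE ->]]]]; rewrite -lee_fin EFinM i_isom FE.
exact: rnorm_le_norm_R.
Qed.

(** The difference of two images is an image of the zero tensor, so the norm estimate forces it to
    vanish. *)
Lemma tensor_image_uniq F S T : tensor_image u F S -> tensor_image u F T -> S = T.
Proof.
move=> FS FT; have := tensor_image_bound _ _ (tensor_image_linear _ (-1) _ _ _ _ FS FT).
rewrite !scaleN1r addNr linear0 rnorm0 mulr0 => h.
by apply/esym/eqP; rewrite -subr_eq0 addrC; apply/eqP/rnorm_eq0/le_anti;
  rewrite rnorm_ge0 h.
Qed.

End NormR.

Section Extension.
Context {R : realType} {d : measure_display} {Omega : measurableType d}.
Context {P : probability Omega R} {eps : nat -> {RV P >-> R}}.
Hypothesis heps : rademacher_sequence eps.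
Context {K : topologicalType} {cK : compact [set: K]}.
Context {X : completeNormedModType R[i]}.
Context {u : {linear CK R cK -> BX X}}.
Hypothesis ub : bounded_map u.
Hypothesis uM : forall f g : CK R cK, u (f * g) = u f * u g.
Context {Z : completeNormedModType R[i]}.
Context {i : {linear tensor cK (commutant u) -> Z}}.
Hypothesis i_completion : is_R_completion eps i.

(* Extending [F |-> u0 F x] for each vector [x] only uses that [X] is complete,
   not that [BX X] is. *)
Lemma completion_extension : exists uhat : {linear Z -> BX X},
  (forall z, rnorm (uhat z) <= opnorm u ^+ 2 * rnorm z) /\
  (forall F S, tensor_image u F S -> uhat (i F) = S).
Proof.
have [i_isom i_dense] := i_completion.
have uniq := tensor_image_uniq heps ub uM i_isom.
have A0 : 0 <= opnorm u ^+ 2 by rewrite exprn_ge0 ?opnorm_ge0.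
have /choice[u0 u0P] := tensor_image_ex u.
have u0l a F G : u0 (a *: F + G) = a *: u0 F + u0 G.
  exact: uniq (u0P _) (tensor_image_linear u a _ _ _ _ (u0P F) (u0P G)).
have u0_bound F : rnorm (u0 F) <= opnorm u ^+ 2 * rnorm (i F).
  exact: (tensor_image_bound heps ub uM i_isom _ _ (u0P F)).
have /choice[W WP] : forall x : X, exists W : Z -> X,
    [/\ linear W, forall F, W (i F) = u0 F x &
      forall z, rnorm (W z) <= opnorm u ^+ 2 * rnorm x * rnorm z].
  move=> x; apply: (dense_extension i_dense (fun F => u0 F x)).
  - by rewrite mulr_ge0 ?rnorm_ge0.
  - by move=> a F G; rewrite u0l.
  - move=> F; apply: le_trans (BX_rnorm_le _ _) _.
    by rewrite mulrAC ler_wpM2r ?rnorm_ge0.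
(* Both sides are bounded and linear in [z] and agree on the dense range of [i]. *)
have W_linear a x y z : W (a *: x + y) z = a *: W x z + W y z.
  have [l1 i1 b1] := WP (a *: x + y); have [l2 i2 b2] := WP x.
  have [l3 i3 b3] := WP y.
  apply/eqP; rewrite -subr_eq0; apply/eqP; move: z.
  apply: (bounded_linear_eq0 i_dense
    (fun z => W (a *: x + y) z - (a *: W x z + W y z))).
  - move=> c z z'; rewrite l1 l2 l3 [a *: (_ + _)]scalerDr scalerA (mulrC a c).
    by rewrite -scalerA [X in _ - X]addrACA -scalerDr opprD addrACA -scalerBr.
  - exists (opnorm u ^+ 2 * rnorm (a *: x + y) + (rnorm (a : R[i]^o) *
      (opnorm u ^+ 2 * rnorm x) + opnorm u ^+ 2 * rnorm y)) => z.
    apply: le_trans (ler_rnormD _ _) _; rewrite rnormN mulrDl lerD//.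
    apply: le_trans (ler_rnormD _ _) _; rewrite mulrDl lerD// rnormZ -mulrA.
    by rewrite ler_wpM2l ?rnorm_ge0.
  - by move=> F; rewrite i1 i2 i3 BX_linear subrr.
have W_op z : (fun x => W x z) \in bounded_op_pred.
  apply/asboolP; split=> [a x y|]; first exact: W_linear.
  exists (opnorm u ^+ 2 * rnorm z) => x; rewrite mulrAC.
  by have [_ _] := WP x.
pose uhat z : BX X := MkBX (W_op z).
have uhat_linear : linear uhat.
  by move=> a z z'; apply/val_inj/funext => x; have [l _ _] := WP x; exact: l.
pose uhatL := GRing.isLinear.Build _ _ _ _ uhat uhat_linear.
exists (HB.pack uhat uhatL : {linear Z -> BX X}); split=> [z|F S FS] /=.
  apply: le_rnorm_BX => [|x]; first by rewrite mulr_ge0 ?rnorm_ge0.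
  by rewrite mulrAC; have [_ _] := WP x; exact.
rewrite -(uniq _ _ _ (u0P F) FS); apply/val_inj/funext => x.
by have [_ + _] := WP x; exact.
Qed.

End Extension.

Theorem theorem2p6 (R : realType)
    (d : measure_display) (Omega : measurableType d) (P : probability Omega R)
    (eps : nat -> {RV P >-> R}) (heps : rademacher_sequence eps)
    (K : topologicalType) (cK : compact [set: K]) (hK : hausdorff_space K)
    (X : completeNormedModType R[i])
    (u : {linear CK R cK -> BX X}) (ub : bounded_map u)
    (uM : forall f g : CK R cK, u (f * g) = u f * u g) :
  (forall (n : nat) (f : 'I_n -> CK R cK) (b : 'I_n -> BX X),
     (forall k, commutant u (b k)) ->
     ((rnorm (\sum_(k < n) u (f k) * b k))%:E <=
        ((opnorm u) ^+ 2)%:E * norm_R eps (tensor_fun f b))%E) /\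
  (forall (Z : completeNormedModType R[i])
      (i : {linear tensor cK (commutant u) -> Z}),
     is_R_completion eps i ->
     exists uhat : {linear Z -> BX X},
       [/\ bounded_map uhat,
           forall (f : CK R cK) (b : BX X) (hb : commutant u b),
             uhat (i (pure_tensor f hb)) = u f * b,
           opnorm uhat <= opnorm u ^+ 2 &
           forall v : {linear Z -> BX X}, bounded_map v ->
             (forall (f : CK R cK) (b : BX X) (hb : commutant u b),
                v (i (pure_tensor f hb)) = u f * b) ->
             forall z, v z = uhat z]).
Proof.
split=> [n f b|Z i i_completion]; first exact: rnorm_le_norm_R.
have [uhat [uhat_bound uhatE]] := completion_extension heps ub uM i_completion.
exists uhat; split.
- by exists (opnorm u ^+ 2).
- by move=> f b hb; exact/uhatE/tensor_image_pure.
- apply: opnorm_le => z z1; apply: le_trans (uhat_bound z) (ler_piMr _ z1).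
  by rewrite exprn_ge0 ?opnorm_ge0.
(* Uniqueness: the difference is bounded and linear, and vanishes on pure tensors, hence on the
   dense range of [i]. *)
move=> v [M vM] vE z; apply/eqP; rewrite -subr_eq0; apply/eqP; move: z.
apply: (bounded_linear_eq0 (proj2 i_completion) (fun z => v z - uhat z)).
- by move=> a z z'; rewrite (linearP v) (linearP uhat) opprD addrACA -scalerBr.
- exists (M + opnorm u ^+ 2) => z; rewrite mulrDl.
  by apply: le_trans (ler_rnormD _ _) _; rewrite rnormN lerD.
move=> F; have [n [f [b [hb ->]]]] := tensor_sum_pure u F.
rewrite linear_sum (linear_sum v) (linear_sum uhat) -sumrB big1// => k _.
by rewrite vE (uhatE _ _ (tensor_image_pure u _ _ _)) subrr.
Qed.
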